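(* Let $N$ be a finitary plain structural conflict net without a fully reachable pure $\mathsf M$. Then $N$ is distributable up to $\approx^\Delta_{bSTb}$, i.e. there exists a distributed Petri net $D$ with $D\approx^\Delta_{bSTb}N$.
   Context: Fix a set $\mathrm{Act}$ of visible actions and an invisible action $\tau\notin\mathrm{Act}$. A (labelled) Petri net is a tuple $N=(S,T,F,M_0,\ell)$ with $S,T$ disjoint sets of places and transitions, $F:(S\times T)\cup(T\times S)\to\mathbb N$, $M_0\in\mathbb N^S$ and $\ell:T\to\mathrm{Act}\cup\{\tau\}$. For $x\in S\cup T$, ${}^\bullet x(y)=F(y,x)$ and $x^\bullet(y)=F(x,y)$ (multisets), extended additively to finite multisets. Multiset $\le,\cap,\cup$ are pointwise $\le$, min, max. For a finite nonempty multiset $G$ of transitions, $M[G\rangle M'$ iff ${}^\bullet G\le M$ and $M'=M-{}^\bullet G+G^\bullet$; reachable markings are those obtained from $M_0$ by such steps. $t\smile u$ iff $M[\{t\}+\{u\}\rangle$ for some reachable $M$. Structural conflict net: $t\smile u\Rightarrow{}^\bullet t\cap{}^\bullet u=\emptyset$. Plain: $\ell$ injective, never $\tau$. Finitary: ${}^\bullet t\ne\emptyset$ for all $t$, and each reachable marking is finite and enables finitely many transitions. Fully reachable pure $\mathsf M$: transitions $t,u,v$ with ${}^\bullet t\cap{}^\bullet u\neq\emptyset$, ${}^\bullet u\cap{}^\bullet v\neq\emptyset$, ${}^\bullet t\cap{}^\bullet v=\emptyset$ and a reachable $M$ with ${}^\bullet t\cup{}^\bullet u\cup{}^\bullet v\le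 M$. A net is distributed iff there is a function $D$ on $S\cup T$ with (1) $s\in{}^\bullet t\Rightarrow D(t)=D(s)$ and (2) $t\smile u\Rightarrow D(t)\ne D(u)$. $\approx^\Delta_{bSTb}$ (branching ST-bisimilarity with explicit divergence): LTS notation $\Rightarrow$ = reflexive transitive closure of $\xrightarrow{\tau}$, $\mathfrak M\xrightarrow{(\alpha)}\mathfrak M'$ iff $\mathfrak M\xrightarrow{\alpha}\mathfrak M'$ or ($\alpha=\tau$, $\mathfrak M=\mathfrak M'$). A branching bisimulation with explicit divergence is $\mathcal B\subseteq\mathfrak S_1\times\mathfrak S_2$ relating the initial states such that whenever $\mathfrak M_1\mathcal B\mathfrak M_2$ and $\mathfrak M_1\xrightarrow{\alpha}\mathfrak M_1'$ there are $\mathfrak M_2\Rightarrow\mathfrak M_2^\dagger\xrightarrow{(\alpha)}\mathfrak M_2'$ with $\mathfrak M_1\mathcal B\mathfrak M_2^\dagger$, $\mathfrak M_1'\mathcal B\mathfrak M_2'$, and symmetrically; and whenever $\mathfrak M_1\mathcal B\mathfrak M_2$ and $\mathfrak M_1=\mathfrak M_1^0\xrightarrow{\tau}\mathfrak M_1^1\xrightarrow{\tau}\cdots$ infinitely with all $\mathfrak M_1^k\mathcal B\mathfrak M_2$, there is an infinite $\mathfrak M_2=\mathfrak M_2^0\xrightarrow{\tau}\mathfrak M_2^1\xrightarrow{\tau}\cdots$ with $\mathfrak M_1^k\mathcal B\mathfrak M_2^l$ for all $k,l$, and symmetrically. The ST-LTS of a net: states $(M,U)\in\mathbb N^S\times T^*$,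 initial $(M_0,\varepsilon)$; $(M,U)\xrightarrow{a^+}(M-{}^\bullet t,Ut)$ iff $\ell(t)=a\in\mathrm{Act}$ and $M[t\rangle$; $(M,U)\xrightarrow{a^{-n}}(M+t^\bullet,U^{-n})$ iff the $n$-th element $t$ of $U$ has $\ell(t)=a$ ($U^{-n}$: $U$ with $n$-th element removed); $(M,U)\xrightarrow{\tau}(M',U)$ iff $M[t\rangle M'$ with $\ell(t)=\tau$. Two nets are $\approx^\Delta_{bSTb}$ iff their ST-LTSs are related by such a $\mathcal B$. *)

(* Defs.v *)
From Stdlib Require Import List Arith.
Import ListNotations.
Set Implicit Arguments.

(* A labelled Petri net over visible actions Act; the label [None] is tau.
   F is split into F_in (S x T) and F_out (T x S). *)
Record net (Act S T : Type) := Net {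
  F_in  : S -> T -> nat;
  F_out : T -> S -> nat;
  M0    : S -> nat;
  lab   : T -> option Act
}.

Section Nets.
Variables (Act S T : Type) (N : net Act S T).

Definition marking := S -> nat.

(* preset / postset of a finite multiset of transitions, given as a list *)
Definition preG (G : list T) (s : S) : nat :=
  fold_right (fun t acc => F_in N s t + acc) 0 G.
Definition postG (G : list T) (s : S) : nat :=
  fold_right (fun t acc => F_out N t s + acc) 0 G.

Definition step (M : marking) (G : list T) (M' : marking) : Prop :=
  G <> [] /\ (forall s, preG G s <= M s) /\
  (forall s, M' s = M s - preG G s + postG G s).

Inductive reachable : marking -> Prop :=
| reach0 : reachable (M0 N)
| reachS : forall M G M', reachable M -> step M G M' -> reachable M'.

Definition enabled (M : marking) (G : list T) : Prop :=
  G <> [] /\ forall s, preG G s <= M s.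

Definition conc (t u : T) : Prop :=
  exists M, reachable M /\ enabled M [t; u].

Definition presets_disjoint (t u : T) : Prop :=
  forall s, Nat.min (F_in N s t) (F_in N s u) = 0.

Definition structural_conflict : Prop :=
  forall t u, conc t u -> presets_disjoint t u.

Definition plain : Prop :=
  (forall t u, lab N t = lab N u -> t = u) /\ (forall t, lab N t <> None).

Definition finitary : Prop :=
  (forall t, exists s, 0 < F_in N s t) /\
  (forall M, reachable M ->
     (exists ls : list S, forall s, 0 < M s -> In s ls) /\
     (exists lt : list T, forall t, enabled M [t] -> In t lt)).

Definition fully_reachable_pure_M : Prop :=
  exists t u v,
    ~ presets_disjoint t u /\ ~ presets_disjoint u v /\ presets_disjoint t v /\
    exists M, reachable M /\
      forall s, Nat.max (F_in N s t) (Nat.max (F_in N s u) (F_in N s v)) <= M s.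

Definition distributed : Prop :=
  exists (Loc : Type) (D : S + T -> Loc),
    (forall s t, 0 < F_in N s t -> D (inr t) = D (inl s)) /\
    (forall t u, conc t u -> D (inr t) <> D (inr u)).

Inductive stlab : Type :=
| LPlus  : Act -> stlab
| LMinus : Act -> nat -> stlab     (* a^{-n}, n is 1-based *)
| LTau   : stlab.

Definition ststate := (marking * list T)%type.

Definition remove_nth (n : nat) (U : list T) : list T :=
  firstn (n - 1) U ++ skipn n U.

Definition ststep (p : ststate) (l : stlab) (q : ststate) : Prop :=
  let (M, U) := p in let (M', U') := q in
  match l with
  | LPlus a => exists t, lab N t = Some a /\ enabled M [t] /\
               (forall s, M' s = M s - F_in N s t) /\ U' = U ++ [t]
  | LMinus a n => exists t, 1 <= n /\ nth_error U (n - 1) = Some t /\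
               lab N t = Some a /\
               (forall s, M' s = M s + F_out N t s) /\ U' = remove_nth n U
  | LTau => exists t, lab N t = None /\ step M [t] M' /\ U' = U
  end.

Definition stinit : ststate := (M0 N, []).

End Nets.

Section Branching.
Variables (L : Type) (tau : L).

Inductive taustar {St : Type} (stp : St -> L -> St -> Prop) : St -> St -> Prop :=
| ts_refl : forall p, taustar stp p p
| ts_step : forall p p' p'', stp p tau p' -> taustar stp p' p'' -> taustar stp p p''.

Definition opt_step {St : Type} (stp : St -> L -> St -> Prop) (p : St) (a : L) (p' : St) :=
  stp p a p' \/ (a = tau /\ p = p').

Definition bb_transfer {St1 St2 : Type} (st1 : St1 -> L -> St1 -> Prop)
  (st2 : St2 -> L -> St2 -> Prop) (B : St1 -> St2 -> Prop) : Prop :=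
  forall p q, B p q -> forall a p', st1 p a p' ->
    exists q1 q', taustar st2 q q1 /\ opt_step st2 q1 a q' /\ B p q1 /\ B p' q'.

Definition div_transfer {St1 St2 : Type} (st1 : St1 -> L -> St1 -> Prop)
  (st2 : St2 -> L -> St2 -> Prop) (B : St1 -> St2 -> Prop) : Prop :=
  forall p q, B p q -> forall f : nat -> St1,
    f 0 = p -> (forall k, st1 (f k) tau (f (S k))) -> (forall k, B (f k) q) ->
    exists g : nat -> St2, g 0 = q /\ (forall l, st2 (g l) tau (g (S l))) /\
      (forall k l, B (f k) (g l)).

Definition flip {A B : Type} (R : A -> B -> Prop) : B -> A -> Prop := fun b a => R a b.

Definition branching_bisim_div {St1 St2 : Type} (st1 : St1 -> L -> St1 -> Prop)
  (st2 : St2 -> L -> St2 -> Prop) (B : St1 -> St2 -> Prop) : Prop :=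
  bb_transfer st1 st2 B /\ bb_transfer st2 st1 (flip B) /\
  div_transfer st1 st2 B /\ div_transfer st2 st1 (flip B).
End Branching.

Definition bSTb_div_equiv {Act S1 T1 S2 T2 : Type}
  (N1 : net Act S1 T1) (N2 : net Act S2 T2) : Prop :=
  exists B : ststate S1 T1 -> ststate S2 T2 -> Prop,
    B (stinit N1) (stinit N2) /\
    branching_bisim_div (@LTau Act) (ststep N1) (ststep N2) B.

(* Main.v *)
From Stdlib Require Import List Arith Lia Permutation.
From Stdlib Require Import ClassicalEpsilon FunctionalExtensionality.
Require Import Defs.
Import ListNotations.

(** The implementation consists of a central coordinator and of infinitely many
    one-shot workers.  The coordinator simulates [N] with some delay: its state
    holds a reachable marking of [N] and an assignment of transitions enabled
    there to workers.  Without a fully reachable pure M, presets overlapping is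
    an equivalence relation on the transitions enabled at a reachable marking,
    so each conflict cluster can be given to a single worker, which decides the
    conflict by executing one transition and reporting it to the coordinator.
    Distinct workers handle disjoint presets and may run concurrently.  A newly
    enabled transition overlaps with at most one existing cluster; hence
    clusters only grow until their conflict is decided, and no offer ever has to
    be revoked.  All invisible steps are inert and they terminate, because the
    coordinator has finitely many reports to process and, between two reports,
    finitely many enabled transitions to assign. *)

(** * Indicators of propositions *)

(** Arc weights compare coordinator states, which contain functions, so the case distinction has to
    be classical. *)
Definition ind (P : Prop) : nat := if excluded_middle_informative P then 1 else 0.

Lemma ind_true (P : Prop) : P -> ind P = 1.
Proof. unfold ind; destruct (excluded_middle_informative P); tauto. Qed.

Lemma ind_false (P : Prop) : ~ P -> ind P = 0.
Proof. unfold ind; destruct (excluded_middle_informative P); tauto. Qed.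

Lemma ind_pos (P : Prop) : 1 <= ind P -> P.
Proof. unfold ind; destruct (excluded_middle_informative P); [tauto | lia]. Qed.

Lemma ind_ext (P Q : Prop) : (P <-> Q) -> ind P = ind Q.
Proof.
  intros H; unfold ind.
  destruct (excluded_middle_informative P), (excluded_middle_informative Q); tauto.
Qed.

Ltac case_ind :=
  unfold ind in *;
  repeat match goal with
    | |- context [excluded_middle_informative ?P] =>
        destruct (excluded_middle_informative P)
    | H : context [excluded_middle_informative ?P] |- _ =>
        destruct (excluded_middle_informative P)
    end.

(** * Steps and presets in Petri nets; removal from lists *)

Section PetriNets.
Context {Act S T : Type} (N : net Act S T).

Lemma preG_perm (G H : list T) (s : S) :
  Permutation G H -> preG N G s = preG N H s.
Proof. induction 1; simpl; lia. Qed.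

Lemma postG_app (G H : list T) (s : S) :
  postG N (G ++ H) s = postG N G s + postG N H s.
Proof. induction G; simpl; lia. Qed.

Lemma preG_in (G : list T) (t : T) (s : S) : In t G -> F_in N s t <= preG N G s.
Proof. induction G; simpl; intros []; subst; [lia | specialize (IHG H); lia]. Qed.

(** A step can be fired one transition at a time, because its starting marking covers all presets
    together; invariants therefore only need checking for single firings. *)
Lemma reachable_ind_single (I : marking S -> Prop) :
  I (M0 N) ->
  (forall M t M', I M -> (forall s, F_in N s t <= M s) ->
     (forall s, M' s = M s - F_in N s t + F_out N t s) -> I M') ->
  forall M, reachable N M -> I M.
Proof.
  intros H0 HS M HM; induction HM as [|M G M' _ IH [_ [Hle Heq]]]; [exact H0|].
  revert M IH Hle Heq; induction G as [|t G IHG]; simpl; intros M IM Hle Heq.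
  - assert (M' = M) as -> by (extensionality s; rewrite Heq; lia). exact IM.
  - apply (IHG (fun s => M s - F_in N s t + F_out N t s)).
    + eapply HS; [exact IM | | reflexivity]. intros s; specialize (Hle s); lia.
    + intros s; specialize (Hle s); lia.
    + intros s; rewrite Heq; specialize (Hle s); lia.
Qed.

Lemma presets_disjoint_sym (t u : T) :
  presets_disjoint N t u -> presets_disjoint N u t.
Proof. intros H s; rewrite Nat.min_comm; apply H. Qed.

Lemma not_disjoint_self (t : T) : finitary N -> ~ presets_disjoint N t t.
Proof. intros [H _] D; destruct (H t) as [s Hs]; specialize (D s); lia. Qed.

(** At most one entry of [l] consumes from [s], so the sum collapses to 0 or to a single weight. The
    labels in [X] tell entries apart. *)
Lemma preG_disjoint_le (X : Type) (M : marking S) (l : list (X * T)) (s : S) :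
  NoDup (map fst l) ->
  (forall n t, In (n, t) l -> F_in N s t <= M s) ->
  (forall n t m u, In (n, t) l -> In (m, u) l -> n <> m -> presets_disjoint N t u) ->
  preG N (map snd l) s <= M s.
Proof.
  intros ND Hen Hdis.
  assert (preG N (map snd l) s = 0 \/
          exists n t, In (n, t) l /\ preG N (map snd l) s = F_in N s t) as H.
  { clear Hen; induction l as [|[n t] l IH]; simpl in *; [auto|].
    inversion ND as [|? ? Hn ND']; subst.
    destruct IH as [-> | (m & u & Hin & E)]; [exact ND' | eauto | |].
    - right; exists n, t; split; [now left | lia].
    - assert (n <> m) as Hnm.
      { intros ->; apply Hn; apply (in_map fst) in Hin; exact Hin. }
      pose proof (Hdis n t m u (or_introl eq_refl) (or_intror Hin) Hnm s) as D.
      destruct (F_in N s t) eqn:Et.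
      + right; exists m, u; split; [now right | lia].
      + right; exists n, t; split; [now left | lia]. }
  destruct H as [-> | (n & t & Hin & ->)]; [lia | eauto].
Qed.

End PetriNets.

Lemma nth_error_remove_nth (X : Type) (n : nat) (l : list X) (x : X) :
  1 <= n -> nth_error l (n - 1) = Some x ->
  exists l1 l2, l = l1 ++ x :: l2 /\ remove_nth n l = l1 ++ l2.
Proof.
  intros Hn H; destruct (nth_error_split _ _ H) as (l1 & l2 & -> & E).
  exists l1, l2; split; [reflexivity|]; unfold remove_nth.
  rewrite firstn_app, skipn_app, E.
  replace (n - 1 - (n - 1)) with 0 by lia.
  replace (n - (n - 1)) with 1 by lia.
  rewrite firstn_all2, skipn_all2 by lia; simpl.
  now rewrite app_nil_r.
Qed.

Lemma remove_nth_map (X Y : Type) (f : X -> Y) (n : nat) (l : list X) :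
  remove_nth n (map f l) = map f (remove_nth n l).
Proof. unfold remove_nth; now rewrite map_app, firstn_map, skipn_map. Qed.

(** * The implementing net and its distribution *)

Section Implementation.
Context {Act S T : Type} (N : net Act S T).

Record coordinator := Coordinator {
  c_marking : marking S;
  c_assigned : list (nat * T);
  c_fresh : nat
}.

Definition fire (M : marking S) (u : T) : marking S :=
  fun s => M s - F_in N s u + F_out N u s.

Definition assignable (q : coordinator) (n : nat) (u : T) : Prop :=
  (forall s, F_in N s u <= c_marking q s) /\
  (forall m, ~ In (m, u) (c_assigned q)) /\
  ((exists v, In (n, v) (c_assigned q) /\ ~ presets_disjoint N u v) \/
   (n = c_fresh q /\ forall m v, In (m, v) (c_assigned q) -> presets_disjoint N u v)).

(** The counter grows even if [n] is an old worker: [c_fresh] is only a strict upper bound on the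
    names in use. *)
Definition assign (q : coordinator) (n : nat) (u : T) : coordinator :=
  Coordinator (c_marking q) ((n, u) :: c_assigned q) (1 + c_fresh q).

(** The whole cluster of [n] is dropped, its conflict being decided; members enabled afterwards may
    be assigned anew. *)
Definition process (q : coordinator) (n : nat) (u : T) : coordinator :=
  Coordinator (fire (c_marking q) u)
    (filter (fun x => negb (Nat.eqb (fst x) n)) (c_assigned q)) (c_fresh q).

(** The coordinator is a sequential automaton: the marked [Coord] place is its current state. Tokens
    on [Offer n u] left behind by a decided conflict are harmless garbage, since the one token of
    [Alive n] is gone. *)
Inductive place :=
| Coord (q : coordinator)
| Done (n : nat) (u : T)
| Alive (n : nat)
| Offer (n : nat) (u : T).

(** The guard of [Assign] is built into the transition as a proof; for [Process] the token on
    [Done n u] acts as guard. *)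
Inductive trans :=
| Exec (n : nat) (u : T)
| Assign (q : coordinator) (n : nat) (u : T) (H : assignable q n u)
| Process (q : coordinator) (n : nat) (u : T).

Definition impl_in (p : place) (t : trans) : nat :=
  match p, t with
  | Alive m, Exec n u => ind (m = n)
  | Offer m v, Exec n u => ind ((m, v) = (n, u))
  | Coord q', Assign q n u _ => ind (q' = q)
  | Coord q', Process q n u => ind (q' = q)
  | Done m v, Process q n u => ind ((m, v) = (n, u))
  | _, _ => 0
  end.

Definition impl_out (t : trans) (p : place) : nat :=
  match t, p with
  | Exec n u, Done m v => ind ((m, v) = (n, u))
  | Assign q n u _, Coord q' => ind (q' = assign q n u)
  | Assign q n u _, Offer m v => ind ((m, v) = (n, u))
  | Process q n u, Coord q' => ind (q' = process q n u)
  | _, _ => 0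
  end.

Definition impl_M0 (p : place) : nat :=
  match p with
  | Coord q => ind (q = Coordinator (M0 N) [] 0)
  | Alive _ => 1
  | _ => 0
  end.

Definition impl : net Act place trans :=
  Net impl_in impl_out impl_M0
    (fun t => match t with Exec _ u => lab N u | _ => None end).

Definition location (x : place + trans) : nat :=
  match x with
  | inl (Coord _) | inl (Done _ _) | inr (Assign _ _ _ _) | inr (Process _ _ _) => 0
  | inl (Alive n) | inl (Offer n _) | inr (Exec n _) => 1 + n
  end.

(** Transitions at one location compete for a single token: coordinator steps for the unique [Coord]
    token, executions by worker [n] for the one on [Alive n]. *)
Lemma impl_distributed : distributed impl.
Proof.
  exists nat, location; split.
  - intros [] []; simpl; try lia; case_ind; try lia; congruence.
  - intros t u (M & HM & _ & Hen) E.
    assert ((exists q, forall q', M (Coord q') = ind (q' = q)) /\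
            (forall n, M (Alive n) <= 1)) as [[q Hq] Ha].
    { revert M HM Hen; intros M HM _; revert M HM.
      apply (reachable_ind_single impl
        (fun M => (exists q, forall q', M (Coord q') = ind (q' = q)) /\
                  (forall n, M (Alive n) <= 1))).
      - split; [eexists; reflexivity | reflexivity].
      - intros M v M' [[q Hq] Ha] Hle Heq; split.
        + assert (forall q1, (forall q', F_in impl (Coord q') v = ind (q' = q1)) ->
                    q1 = q) as Hq1.
          { intros q1 H1. specialize (Hle (Coord q1)). rewrite H1, Hq, (ind_true (q1 = q1)) in Hle
              by reflexivity. exact (ind_pos _ Hle). }
          destruct v as [n v|q1 n v Hv|q1 n v].
          * exists q; intros q'; rewrite Heq, Hq; simpl; lia.
          * assert (q1 = q) as -> by (apply Hq1; reflexivity).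
            eexists; intros q'; rewrite Heq, Hq; simpl; rewrite Nat.sub_diag; reflexivity.
          * assert (q1 = q) as -> by (apply Hq1; reflexivity).
            eexists; intros q'; rewrite Heq, Hq; simpl; rewrite Nat.sub_diag; reflexivity.
        + intros n; rewrite Heq; specialize (Ha n).
          destruct v; simpl; lia. }
    assert (forall q', ind (q' = q) <= 1) as Hi by (intros; case_ind; lia).
    destruct t as [n v|q1 n v Hv|q1 n v], u as [m w|q2 m w Hw|q2 m w];
      simpl in E; try discriminate.
    1: { injection E as <-; specialize (Hen (Alive n)); specialize (Ha n); simpl in Hen.
         rewrite ind_true in Hen by reflexivity; lia. }
    all: pose proof (Hen (Coord q1)) as H1; pose proof (Hen (Coord q2)) as H2;
      rewrite Hq in H1, H2; simpl in H1, H2;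
      assert (q1 = q) as -> by
        (apply ind_pos; rewrite (ind_true (q1 = q1)) in H1 by reflexivity; lia);
      assert (q2 = q) as -> by
        (apply ind_pos; rewrite (ind_true (q2 = q2)) in H2 by reflexivity; lia);
      rewrite ind_true in H1 by reflexivity; lia.
Qed.

(** * Conflict clusters and coherent coordinator states *)

Hypothesis N_finitary : finitary N.
Hypothesis N_plain : plain N.
Hypothesis N_sc : structural_conflict N.
Hypothesis N_noM : ~ fully_reachable_pure_M N.

(** Otherwise [t], [u], [v] form a pure M with [u] in the middle, and [M] covers the union of the
    presets because it enables each of them. *)
Lemma overlap_trans (M : marking S) (t u v : T) :
  reachable N M ->
  (forall s, F_in N s t <= M s) -> (forall s, F_in N s u <= M s) ->
  (forall s, F_in N s v <= M s) ->
  ~ presets_disjoint N t u -> ~ presets_disjoint N u v -> ~ presets_disjoint N t v.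
Proof.
  intros HM Ht Hu Hv Htu Huv Htv; apply N_noM; exists t, u, v.
  repeat split; auto; exists M; split; [exact HM|].
  intros s; specialize (Ht s); specialize (Hu s); specialize (Hv s); lia.
Qed.

(** By [coh_cluster] workers correspond to overlap classes; since presets are nonempty, the case
    [u = v] also gives every assigned transition a unique worker. *)
Record coherent (q : coordinator) : Prop := {
  coh_reach : reachable N (c_marking q);
  coh_nodup : NoDup (c_assigned q);
  coh_enabled : forall n u s, In (n, u) (c_assigned q) -> F_in N s u <= c_marking q s;
  coh_cluster : forall n u m v, In (n, u) (c_assigned q) -> In (m, v) (c_assigned q) ->
    (n = m <-> ~ presets_disjoint N u v);
  coh_fresh : forall n u, In (n, u) (c_assigned q) -> n < c_fresh q
}.

Lemma coherent_disjoint (q : coordinator) (n m : nat) (u v : T) :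
  coherent q -> In (n, u) (c_assigned q) -> In (m, v) (c_assigned q) -> n <> m ->
  presets_disjoint N u v.
Proof.
  intros C Hu Hv Hnm; apply NNPP; intros D; apply Hnm.
  now apply (coh_cluster _ C n u m v Hu Hv).
Qed.

(** If [u] overlaps one member [w] of a cluster, transitivity makes it overlap all of that cluster
    and nothing assigned elsewhere. A fresh worker has no members to compare with. *)
Lemma coherent_assign (q : coordinator) (n : nat) (u : T) :
  coherent q -> assignable q n u -> coherent (assign q n u).
Proof.
  intros C (Hen & Hnew & Hn); pose proof C as [CR CN CE CC CF].
  assert (forall m v, In (m, v) (c_assigned q) -> (n = m <-> ~ presets_disjoint N u v)) as Hc.
  { intros m v Hv; destruct Hn as [(w & Hw & Huw) | [-> Hd]].
    - rewrite (CC n w m v Hw Hv); split; intros H.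
      + apply (overlap_trans (c_marking q) u w v); eauto.
      + apply (overlap_trans (c_marking q) w u v); eauto.
        intros D; apply Huw; now apply presets_disjoint_sym.
    - split; [intros <-; specialize (CF _ _ Hv); lia|].
      intros H; exfalso; eauto. }
  constructor; simpl.
  - exact CR.
  - constructor; auto.
  - intros m v s [[= <- <-] | H]; eauto.
  - intros m v m' v' [[= <- <-] | H] [[= <- <-] | H'].
    + split; auto; intros _; now apply not_disjoint_self.
    + auto.
    + split; intros E.
      * intros D; apply (proj1 (Hc _ _ H)); [now symmetry | now apply presets_disjoint_sym].
      * symmetry; apply (proj2 (Hc _ _ H)); intros D; apply E; now apply presets_disjoint_sym.
    + auto.
  - intros m v [[= <- <-] | H].
    + destruct Hn as [(w & Hw & _) | [-> _]]; [specialize (CF _ _ Hw)|]; lia.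
    + specialize (CF _ _ H); lia.
Qed.

Lemma in_process (q : coordinator) (n m : nat) (u v : T) :
  In (m, v) (c_assigned (process q n u)) <-> In (m, v) (c_assigned q) /\ m <> n.
Proof.
  simpl; rewrite filter_In; simpl.
  destruct (Nat.eqb_spec m n); simpl; intuition congruence.
Qed.

(** Other workers keep their offers enabled: their presets are disjoint from that of [u], so firing
    [u] takes no token from them. *)
Lemma coherent_process (q : coordinator) (n : nat) (u : T) :
  coherent q -> In (n, u) (c_assigned q) -> coherent (process q n u).
Proof.
  intros C Hu; pose proof C as [CR CN CE CC CF].
  constructor.
  - apply (reachS CR (G := [u])); repeat split; simpl.
    + discriminate.
    + intros s; specialize (CE n u s Hu); lia.
    + intros s; unfold fire; lia.
  - apply NoDup_filter; exact CN.
  - intros m v s [Hv Hmn]%in_process; simpl; unfold fire.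
    pose proof (coherent_disjoint _ _ _ _ _ C Hv Hu Hmn s).
    specialize (CE m v s Hv); lia.
  - intros m v m' v' [Hv _]%in_process [Hv' _]%in_process; auto.
  - intros m v [Hv _]%in_process; eauto.
Qed.

(** * Relating states of the two nets; invisible steps *)

(** [W] lists the running transitions with their workers, [P] those that have
    terminated but are not yet processed by the coordinator. *)
Record related (p : ststate place trans) (r : ststate S T)
    (q : coordinator) (W P : list (nat * T)) : Prop := {
  rel_coh : coherent q;
  rel_coord : forall q', fst p (Coord q') = ind (q' = q);
  rel_done : forall n u, fst p (Done n u) = ind (In (n, u) P);
  rel_alive : forall n u, In (n, u) (c_assigned q) ->
    fst p (Alive n) = ind (~ In n (map fst (W ++ P)));
  rel_alive_fresh : forall n, c_fresh q <= n -> fst p (Alive n) = 1;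
  rel_offer : forall n u, In (n, u) (c_assigned q) -> ~ In n (map fst (W ++ P)) ->
    1 <= fst p (Offer n u);
  rel_offered : forall n u, 1 <= fst p (Offer n u) -> 1 <= fst p (Alive n) ->
    In (n, u) (c_assigned q);
  rel_offer_fresh : forall n u, c_fresh q <= n -> fst p (Offer n u) = 0;
  rel_busy : incl (W ++ P) (c_assigned q);
  rel_nodup : NoDup (map fst (W ++ P));
  rel_run : snd p = map (fun x => Exec (fst x) (snd x)) W;
  rel_run' : snd r = map snd W;
  rel_marking : forall s, fst r s + preG N (map snd (W ++ P)) s
    = c_marking q s + postG N (map snd P) s
}.

Lemma related_init : related (stinit impl) (stinit N) (Coordinator (M0 N) [] 0) [] [].
Proof.
  constructor; simpl; try (intros; tauto); try (intros; lia); try reflexivity.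
  - constructor; simpl; try tauto; constructor.
  - intros; rewrite ind_false; tauto.
  - easy.
  - constructor.
Qed.

Lemma related_assign p r q W P n u (H : assignable q n u) M' :
  related p r q W P ->
  (forall s, M' s = fst p s - impl_in s (Assign q n u H) + impl_out (Assign q n u H) s) ->
  related (M', snd p) r (assign q n u) W P.
Proof.
  intros [] E; pose proof H as (Hen & Hnew & Hn).
  constructor; simpl; auto.
  - now apply coherent_assign.
  - intros q'; rewrite E; simpl; rewrite rel_coord0; lia.
  - intros; rewrite E; simpl; rewrite rel_done0; lia.
  - intros m v Hin; rewrite E; simpl; rewrite Nat.sub_0_r, Nat.add_0_r.
    destruct Hin as [[= <- <-] | Hin]; [|eauto].
    destruct Hn as [(w & Hw & _) | [-> _]]; [eauto|].
    (* A fresh worker is still alive, and it is not busy because busy workers have names below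
       [c_fresh q]. *)
    rewrite rel_alive_fresh0 by lia; symmetry; apply ind_true.
    intros ((m & v) & Ev & Hv)%in_map_iff; simpl in Ev; subst m.
    apply rel_busy0 in Hv; apply (coh_fresh _ rel_coh0) in Hv; lia.
  - intros m Hm; rewrite E; simpl; rewrite rel_alive_fresh0; lia.
  - intros m v Hin Hm; rewrite E; simpl.
    destruct Hin as [[= <- <-] | Hin].
    + rewrite ind_true by reflexivity; lia.
    + specialize (rel_offer0 _ _ Hin Hm); lia.
  - intros m v; rewrite !E; simpl; intros H1 H2.
    unfold ind in H1; destruct (excluded_middle_informative _) as [Eq|_].
    + left; congruence.
    + right; apply rel_offered0; lia.
  - intros m v Hm; rewrite E; simpl; rewrite rel_offer_fresh0 by lia.
    rewrite ind_false; [reflexivity|]; intros [= -> ->].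
    destruct Hn as [(w & Hw & _) | [-> _]]; [apply (coh_fresh _ rel_coh0) in Hw|]; lia.
  - intros x Hx; right; auto.
Qed.

(** The coordinator catches up: the effect of [u] moves from the account of [P] in [rel_marking]
    into [c_marking], while [r] is unchanged. *)
Lemma related_process p r q W P n u M' :
  related p r q W P -> In (n, u) P ->
  (forall s, M' s = fst p s - impl_in s (Process q n u) + impl_out (Process q n u) s) ->
  exists P', length P' < length P /\ related (M', snd p) r (process q n u) W P'.
Proof.
  intros [] HP E.
  destruct (in_split _ _ HP) as (l1 & l2 & ->).
  exists (l1 ++ l2); split; [rewrite !length_app; simpl; lia|].
  assert (Permutation (W ++ l1 ++ (n, u) :: l2) ((n, u) :: W ++ l1 ++ l2)) as HB.
  { rewrite !app_assoc; symmetry; apply Permutation_middle. }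
  pose proof (Permutation_map fst HB) as HB1; simpl in HB1.
  pose proof (Permutation_NoDup HB1 rel_nodup0) as ND.
  apply NoDup_cons_iff in ND; destruct ND as [Hfr ND].
  assert (In (n, u) (c_assigned q)) as Hu.
  { apply rel_busy0; rewrite !in_app_iff; simpl; auto. }
  constructor; simpl; auto.
  - now apply coherent_process.
  - intros q'; rewrite E; simpl; rewrite rel_coord0; lia.
  - intros m v; rewrite E; simpl; rewrite rel_done0, Nat.add_0_r.
    unfold ind at 2; destruct (excluded_middle_informative _) as [[= -> ->]|Hne].
    + rewrite ind_true by assumption; rewrite ind_false; [reflexivity|].
      intros Hin; apply Hfr; rewrite map_app, in_app_iff; right.
      apply (in_map fst) in Hin; exact Hin.
    + rewrite Nat.sub_0_r; apply ind_ext; rewrite !in_app_iff; simpl; intuition congruence.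
  - intros m v [Hv Hmn]%(in_process q n m u v); rewrite E; simpl; rewrite Nat.sub_0_r, Nat.add_0_r.
    rewrite (rel_alive0 _ _ Hv); apply ind_ext.
    split; intros H K; apply H.
    + apply (Permutation_in _ (Permutation_sym HB1)); now right.
    + apply (Permutation_in _ HB1) in K; destruct K; [congruence | assumption].
  - intros m Hm; rewrite E; simpl; rewrite rel_alive_fresh0; lia.
  - intros m v [Hv Hmn]%(in_process q n m u v) Hm; rewrite E; simpl.
    enough (1 <= fst p (Offer m v)) by lia; apply rel_offer0; [exact Hv|].
    intros K; apply (Permutation_in _ HB1) in K; destruct K; [congruence | auto].
  - intros m v; rewrite !E; simpl; intros H1 H2; apply (in_process q n m u v).
    assert (In (m, v) (c_assigned q)) as Hv by (apply rel_offered0; lia).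
    split; [exact Hv|]; intros ->.
    (* Remaining offers to [n] do not count, as [n] has terminated and so [Alive n] is empty. *)
    rewrite (rel_alive0 _ _ Hv), ind_false in H2; [lia|].
    intros K; apply K; apply (Permutation_in _ (Permutation_sym HB1)); now left.
  - intros m v Hm; rewrite E; simpl; rewrite rel_offer_fresh0; lia.
  - intros [m v] Hin; apply (in_process q n m u v); split.
    + apply rel_busy0; apply (Permutation_in _ (Permutation_sym HB)); now right.
    + intros ->; apply Hfr; apply (in_map fst) in Hin; exact Hin.
  - intros s; specialize (rel_marking0 s).
    rewrite (preG_perm N _ _ s (Permutation_map snd HB)) in rel_marking0; simpl in rel_marking0.
    rewrite (map_app snd l1), postG_app in rel_marking0 |- *; simpl in rel_marking0.
    (* Enabledness makes the truncated subtraction in [fire] exact. *)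
    pose proof (coh_enabled _ rel_coh0 n u s Hu); unfold fire; lia.
Qed.

(** As [N] is plain, only [Assign] and [Process] are invisible. The disjunction prepares a
    lexicographic descent for termination. *)
Lemma related_tau p r q W P p' :
  related p r q W P -> ststep impl p (LTau Act) p' ->
  exists q' P', related p' r q' W P' /\
    (length P' < length P \/
     P' = P /\ c_marking q' = c_marking q /\
     length (c_assigned q') = 1 + length (c_assigned q)).
Proof.
  destruct p as [M U], p' as [M' U']; intros R (t & Hl & (_ & Hle & Heq) & ->); simpl in *.
  destruct t as [n u|q1 n u H|q1 n u]; [now apply N_plain in Hl| |].
  all: assert (q1 = q) as ->;
    [ specialize (Hle (Coord q1)); simpl in Hle;
      pose proof (rel_coord _ _ _ _ _ R q1) as Hq; simpl in Hq; rewrite Hq in Hle;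
      rewrite (ind_true (q1 = q1)) in Hle by reflexivity; apply ind_pos; lia |].
  - exists (assign q n u), P; split; [|auto].
    apply (related_assign _ _ _ _ _ _ _ H _ R).
    intros s; rewrite Heq; simpl; lia.
  - assert (In (n, u) P) as HP.
    { specialize (Hle (Done n u)); simpl in Hle.
      pose proof (rel_done _ _ _ _ _ R n u) as Hd; simpl in Hd; rewrite Hd in Hle.
      rewrite (ind_true ((n, u) = (n, u))) in Hle by reflexivity; apply ind_pos; lia. }
    destruct (related_process _ _ _ _ _ _ _ M' R HP) as (P' & HP' & R').
    { intros s; rewrite Heq; simpl; lia. }
    eauto.
Qed.

(** The outer induction is on the number of reports, the inner one on the enabled transitions yet to
    be assigned. The list [lt] of enabled transitions is chosen anew whenever a report is
    processed. *)
Lemma related_tau_terminates p r q W P (f : nat -> ststate place trans) :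
  related p r q W P -> f 0 = p ->
  (forall k, ststep impl (f k) (LTau Act) (f (1 + k))) -> False.
Proof.
  remember (length P) as j eqn:Ej; revert p q P f Ej.
  induction j as [j IHj] using lt_wf_ind; intros p q P f Ej R.
  destruct (proj2 (proj2 N_finitary _ (coh_reach _ (rel_coh _ _ _ _ _ R)))) as [lt Hlt].
  remember (length lt - length (c_assigned q)) as d eqn:Ed.
  revert p q P f Ej R Hlt Ed; induction d as [d IHd] using lt_wf_ind.
  intros p q P f Ej R Hlt Ed Hf0 Hf; subst p.
  destruct (related_tau _ _ _ _ _ _ R (Hf 0)) as (q' & P' & R' & [Hlen | (-> & EM & EL)]).
  - eapply (IHj (length P')) with (f := fun k => f (1 + k)); eauto; lia.
  (* The bound is taken after the step, so that the truncated difference strictly decreases. Each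
     transition has only one worker, so forgetting workers creates no duplicates. *)
  - assert (length (c_assigned q') <= length lt) as Hle.
    { rewrite <- (length_map snd); pose proof (rel_coh _ _ _ _ _ R') as C.
      apply NoDup_incl_length.
      - apply NoDup_map_NoDup_ForallPairs; [|apply C].
        intros [n u] [m v] Hu Hv; simpl; intros ->; f_equal.
        apply (coh_cluster _ C _ _ _ _ Hu Hv); now apply not_disjoint_self.
      - intros u ((n & v) & <- & Hv)%in_map_iff; apply Hlt; split; [discriminate|].
        intros s; simpl; pose proof (coh_enabled _ C _ _ s Hv); rewrite <- EM; lia. }
    eapply (IHd (length lt - length (c_assigned q'))) with (f := fun k => f (1 + k)); eauto.
    + lia.
    + now rewrite EM.
Qed.

Lemma related_process_all p r q W P :
  related p r q W P ->
  exists p' q', taustar (LTau Act) (ststep impl) p p' /\ related p' r q' W [].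
Proof.
  remember (length P) as j eqn:Ej; revert p q P Ej.
  induction j as [j IHj] using lt_wf_ind; intros p q P Ej R.
  destruct P as [|[n u] P]; [exists p, q; split; [constructor | exact R]|].
  destruct (related_process _ _ _ _ _ n u
    (fun s => fst p s - impl_in s (Process q n u) + impl_out (Process q n u) s) R
    (or_introl eq_refl) (fun s => eq_refl)) as (P' & HP' & R').
  edestruct IHj as (p' & q' & Ht & R''); [|reflexivity | exact R' |]; [lia|].
  exists p', q'; split; [|exact R''].
  econstructor; [|exact Ht].
  destruct p as [M U]; simpl; exists (Process q n u); repeat split; simpl; try discriminate.
  - intros [q0|m v|m|m v]; simpl; try lia.
    + pose proof (rel_coord _ _ _ _ _ R q0) as H; simpl in H; lia.
    + pose proof (rel_done _ _ _ _ _ R m v) as H; simpl in H; rewrite H.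
      case_ind; try lia; intuition congruence.
  - intros s; lia.
Qed.

(** * Starts and ends of visible transitions *)

(** The coordinator does not notice a start: the tokens taken from [r] are accounted for by the
    preset of the new entry of [W]. *)
Lemma related_exec p r q W P n u M' Mr :
  related p r q W P -> In (n, u) (c_assigned q) -> ~ In n (map fst (W ++ P)) ->
  (forall s, M' s = fst p s - impl_in s (Exec n u)) ->
  (forall s, F_in N s u <= fst r s) ->
  (forall s, Mr s = fst r s - F_in N s u) ->
  related (M', snd p ++ [Exec n u]) (Mr, snd r ++ [u]) q (W ++ [(n, u)]) P.
Proof.
  intros [] Hu Hn E Hle Er.
  assert (Permutation ((W ++ [(n, u)]) ++ P) ((n, u) :: W ++ P)) as HB.
  { rewrite <- app_assoc; symmetry; apply Permutation_middle. }
  pose proof (Permutation_map fst HB) as HB1; simpl in HB1.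
  constructor; simpl; auto.
  - intros q'; rewrite E; simpl; rewrite rel_coord0; lia.
  - intros; rewrite E; simpl; rewrite rel_done0; lia.
  - intros m v Hv; rewrite E; simpl; rewrite (rel_alive0 _ _ Hv).
    unfold ind at 2; destruct (excluded_middle_informative _) as [->|Hne].
    + rewrite ind_true by assumption; rewrite ind_false; [reflexivity|].
      intros K; apply K; apply (Permutation_in _ (Permutation_sym HB1)); now left.
    + rewrite Nat.sub_0_r; apply ind_ext; split; intros H K; apply H.
      * apply (Permutation_in _ HB1) in K; destruct K; [congruence | assumption].
      * apply (Permutation_in _ (Permutation_sym HB1)); now right.
  - intros m Hm; rewrite E; simpl; rewrite rel_alive_fresh0 by exact Hm.
    rewrite ind_false; [reflexivity|]; intros ->.
    apply (coh_fresh _ rel_coh0) in Hu; lia.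
  - intros m v Hv Hm; rewrite E; simpl.
    rewrite ind_false.
    + enough (1 <= fst p (Offer m v)) by lia; apply rel_offer0; [exact Hv|].
      intros K; apply Hm, (Permutation_in _ (Permutation_sym HB1)); now right.
    + intros [= -> ->]; apply Hm, (Permutation_in _ (Permutation_sym HB1)); now left.
  - intros m v; rewrite !E; simpl; intros H1 H2; apply rel_offered0; lia.
  - intros m v Hm; rewrite E; simpl; rewrite rel_offer_fresh0; lia.
  - intros x Hx; apply (Permutation_in _ HB) in Hx; destruct Hx as [<-|Hx]; auto.
  - apply (Permutation_NoDup (Permutation_sym HB1)); constructor; auto.
  - rewrite rel_run0, map_app; reflexivity.
  - rewrite rel_run'0, map_app; reflexivity.
  - intros s; specialize (rel_marking0 s); specialize (Hle s); rewrite Er.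
    rewrite (preG_perm N _ _ s (Permutation_map snd HB)); simpl; lia.
Qed.

(** The pair moves from [W] to [P], so the busy workers stay the same up to permutation, and the
    postset of [u] is added to both sides of [rel_marking]. *)
Lemma related_end p r q W1 W2 P n u M' Mr :
  related p r q (W1 ++ (n, u) :: W2) P ->
  (forall s, M' s = fst p s + impl_out (Exec n u) s) ->
  (forall s, Mr s = fst r s + F_out N u s) ->
  related (M', map (fun x => Exec (fst x) (snd x)) (W1 ++ W2))
    (Mr, map snd (W1 ++ W2)) q (W1 ++ W2) ((n, u) :: P).
Proof.
  intros [] E Er.
  assert (Permutation ((W1 ++ (n, u) :: W2) ++ P) ((W1 ++ W2) ++ (n, u) :: P)) as HB.
  { rewrite <- !app_assoc; apply Permutation_app_head, Permutation_middle. }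
  pose proof (Permutation_map fst HB) as HB1.
  assert (forall m, In m (map fst ((W1 ++ W2) ++ (n, u) :: P)) <->
                    In m (map fst ((W1 ++ (n, u) :: W2) ++ P))) as HI.
  { intros m; split; apply Permutation_in; [now symmetry | exact HB1]. }
  constructor; auto.
  - intros q'; simpl; rewrite E; simpl; rewrite rel_coord0; lia.
  - intros m v; simpl; rewrite E; simpl; rewrite rel_done0.
    unfold ind at 2; destruct (excluded_middle_informative _) as [Eq|Hne].
    + rewrite Eq, (ind_true (_ \/ _)) by (now left); rewrite ind_false; [reflexivity|].
      (* No earlier report of [n] is pending, since busy workers are listed once; hence [Done n u]
         was empty. *)
      intros K; apply (in_map fst) in K; revert K.
      pose proof (Permutation_NoDup HB1 rel_nodup0) as ND.
      rewrite map_app in ND; apply NoDup_remove_2 in ND; rewrite in_app_iff in ND; tauto.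
    + rewrite Nat.add_0_r; apply ind_ext; intuition congruence.
  - intros m v Hv; simpl; rewrite E; simpl; rewrite (rel_alive0 _ _ Hv), Nat.add_0_r.
    apply ind_ext; rewrite HI; reflexivity.
  - intros m Hm; simpl; rewrite E; simpl; rewrite rel_alive_fresh0; lia.
  - intros m v Hv Hm; rewrite HI in Hm; simpl; rewrite E; simpl.
    specialize (rel_offer0 _ _ Hv Hm); lia.
  - intros m v; simpl; rewrite !E; simpl; intros H1 H2; apply rel_offered0; lia.
  - intros m v Hm; simpl; rewrite E; simpl; rewrite rel_offer_fresh0; lia.
  - intros x Hx; apply rel_busy0, (Permutation_in _ (Permutation_sym HB) Hx).
  - exact (Permutation_NoDup HB1 rel_nodup0).
  - intros s; specialize (rel_marking0 s); simpl; rewrite Er.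
    rewrite (preG_perm N _ _ s (Permutation_map snd HB)) in rel_marking0; lia.
Qed.

(** The presets of [u] and of all busy transitions belong to different workers, so [c_marking q]
    covers their sum; what is left after the busy ones have consumed still covers [u]. *)
Lemma related_exec_enabled p r q W P n u :
  related p r q W P -> 1 <= fst p (Alive n) -> 1 <= fst p (Offer n u) ->
  In (n, u) (c_assigned q) /\ ~ In n (map fst (W ++ P)) /\
  forall s, F_in N s u <= fst r s.
Proof.
  intros [] Ha Ho.
  assert (In (n, u) (c_assigned q)) as Hu by auto.
  rewrite (rel_alive0 _ _ Hu) in Ha; apply ind_pos in Ha.
  repeat split; auto; intros s.
  assert (preG N (map snd ((n, u) :: W ++ P)) s <= c_marking q s) as H.
  { assert (incl ((n, u) :: W ++ P) (c_assigned q)) as Hincl.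
    { intros x [<-|Hx]; auto. }
    apply preG_disjoint_le.
    - constructor; auto.
    - intros m v Hv; apply (coh_enabled _ rel_coh0 m v s); auto.
    - intros m v m' v' Hv Hv'; apply (coherent_disjoint q); auto. }
  specialize (rel_marking0 s); simpl in H; lia.
Qed.

(** * The branching ST-bisimulation *)

Definition st_bisim (p : ststate place trans) (r : ststate S T) : Prop :=
  exists q W P, related p r q W P.

Lemma bisim_impl_spec :
  bb_transfer (LTau Act) (ststep impl) (ststep N) st_bisim.
Proof.
  intros p r (q & W & P & R) a p' Hp; destruct a as [a|a n|].
  - destruct p as [M U], p' as [M' U'], r as [Mr Ur].
    destruct Hp as (t & Hl & (_ & Hle) & Heq & ->).
    destruct t as [n u|q1 n u H|q1 n u]; try discriminate.
    destruct (related_exec_enabled _ _ _ _ _ n u R) as (Hu & Hn & Hen).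
    { specialize (Hle (Alive n)); simpl in *; rewrite ind_true in Hle by reflexivity; lia. }
    { specialize (Hle (Offer n u)); simpl in *; rewrite ind_true in Hle by reflexivity; lia. }
    exists (Mr, Ur), ((fun s => Mr s - F_in N s u), Ur ++ [u]).
    repeat split; [constructor | left | exists q, W, P; exact R | exists q, (W ++ [(n, u)]), P].
    + exists u; repeat split; auto; [discriminate|].
      intros s; specialize (Hen s); simpl in *; lia.
    + exact (related_exec _ _ _ _ _ _ _ M' _ R Hu Hn Heq Hen (fun s => eq_refl)).
  - destruct p as [M U], p' as [M' U'], r as [Mr Ur].
    destruct Hp as (t & Hn & Hnth & Hl & Heq & ->).
    destruct t as [m u|q1 m u H|q1 m u]; try discriminate.
    (* Both lists of running transitions are images of [W], so position [n] denotes corresponding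
       transitions. *)
    pose proof (rel_run _ _ _ _ _ R) as HU; pose proof (rel_run' _ _ _ _ _ R) as HUr.
    simpl in HU, HUr; subst U Ur.
    rewrite nth_error_map in Hnth; destruct (nth_error W (n - 1)) as [[m' u']|] eqn:EW;
      [|discriminate].
    injection Hnth as -> ->.
    destruct (nth_error_remove_nth _ _ _ _ Hn EW) as (W1 & W2 & -> & ER).
    exists (Mr, map snd (W1 ++ (m, u) :: W2)),
      ((fun s => Mr s + F_out N u s), map snd (W1 ++ W2)).
    repeat split; [constructor | left | eexists _, _, _; exact R
                  | exists q, (W1 ++ W2), ((m, u) :: P)].
    + exists u; repeat split; auto.
      * now rewrite nth_error_map, EW.
      * now rewrite remove_nth_map, ER.
    + rewrite remove_nth_map, ER.
      exact (related_end _ _ _ _ _ _ _ _ M' _ R Heq (fun s => eq_refl)).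
  - destruct (related_tau _ _ _ _ _ _ R Hp) as (q' & P' & R' & _).
    (* Invisible steps are inert: [N] stays where it is. *)
    exists r, r; repeat split; [constructor | right; auto | exists q, W, P
                         | exists q', W, P']; auto.
Qed.

(** Without pending reports, [c_marking q] is [r] plus the presets of the running transitions, so it
    is a reachable marking enabling [u] and [t] together. *)
Lemma related_conc p r q W u n t :
  related p r q W [] -> (forall s, F_in N s u <= fst r s) -> In (n, t) W ->
  presets_disjoint N u t.
Proof.
  intros R Hu Ht; apply N_sc; exists (c_marking q); split; [apply R|].
  split; [discriminate|]; intros s; simpl.
  pose proof (rel_marking _ _ _ _ _ R s) as H; rewrite app_nil_r in H; simpl in H.
  pose proof (preG_in N (map snd W) t s (in_map snd _ _ Ht)); specialize (Hu s); lia.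
Qed.

(** With no pending reports [c_marking q] dominates [r], so [u] is enabled there; it joins the
    worker of an overlapping assigned transition or else gets the fresh one. *)
Lemma related_assigned p r q W u :
  related p r q W [] -> (forall s, F_in N s u <= fst r s) ->
  exists p' q' n, taustar (LTau Act) (ststep impl) p p' /\
    related p' r q' W [] /\ In (n, u) (c_assigned q').
Proof.
  intros R Hu.
  destruct (classic (exists n, In (n, u) (c_assigned q))) as [[n Hn] | Hnew].
  { exists p, q, n; split; [constructor | split; assumption]. }
  assert (exists n, assignable q n u) as [n Hn].
  { assert (forall s, F_in N s u <= c_marking q s) as Hen.
    { intros s; pose proof (rel_marking _ _ _ _ _ R s) as H; simpl in H.
      specialize (Hu s); lia. }
    destruct (classic (exists n v, In (n, v) (c_assigned q) /\ ~ presets_disjoint N u v))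
      as [(n & v & Hv) | Hno].
    - exists n; split; [exact Hen | split; eauto].
    - exists (c_fresh q); split; [exact Hen | split; [eauto|]]; right; split; [reflexivity|].
      intros m v Hv; apply NNPP; intros D; apply Hno; eauto. }
  exists ((fun s => fst p s - impl_in s (Assign q n u Hn) + impl_out (Assign q n u Hn) s), snd p),
    (assign q n u), n.
  split; [|split; [apply (related_assign _ _ _ _ _ _ _ Hn _ R); reflexivity | now left]].
  econstructor; [|constructor].
  destruct p as [M U]; exists (Assign q n u Hn); repeat split; simpl; try discriminate.
  - intros [q'|m v|m|m v]; simpl; try lia.
    pose proof (rel_coord _ _ _ _ _ R q') as H; simpl in H; lia.
  - intros s; lia.
Qed.

Lemma taustar_trans (St : Type) (stp : St -> stlab Act -> St -> Prop) (x y z : St) :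
  taustar (LTau Act) stp x y -> taustar (LTau Act) stp y z -> taustar (LTau Act) stp x z.
Proof. induction 1; [auto | econstructor; eauto]. Qed.

Lemma bisim_spec_impl :
  bb_transfer (LTau Act) (ststep N) (ststep impl) (flip st_bisim).
Proof.
  intros r p (q & W & P & R) a r' Hr; destruct a as [a|a n|].
  - destruct r as [Mr Ur], r' as [Mr' Ur'].
    destruct Hr as (u & Hl & (_ & Hle) & Heq & ->).
    assert (forall s, F_in N s u <= Mr s) as Hu.
    { intros s; specialize (Hle s); simpl in Hle; lia. }
    destruct (related_process_all _ _ _ _ _ R) as (p1 & q1 & Ht1 & R1).
    destruct (related_assigned _ _ _ _ u R1 Hu) as (p2 & q2 & n & Ht2 & R2 & Hn).
    (* A transition running on worker [n] would overlap [u] by [coh_cluster], yet be disjoint from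
       it by [related_conc]. *)
    assert (~ In n (map fst (W ++ []))) as Hfree.
    { rewrite app_nil_r; intros ((m & t) & Em & Ht)%in_map_iff; simpl in Em; subst m.
      pose proof (related_conc _ _ _ _ _ _ _ R2 Hu Ht) as D; revert D.
      apply (coh_cluster _ (rel_coh _ _ _ _ _ R2) n u n t Hn); [|reflexivity].
      apply (rel_busy _ _ _ _ _ R2); rewrite app_nil_r; exact Ht. }
    pose proof (rel_alive _ _ _ _ _ R2 _ _ Hn) as Ha; rewrite ind_true in Ha by exact Hfree.
    pose proof (rel_offer _ _ _ _ _ R2 _ _ Hn Hfree) as Ho.
    exists p2, ((fun s => fst p2 s - impl_in s (Exec n u)), snd p2 ++ [Exec n u]).
    repeat split; [eapply taustar_trans; eauto | left | eexists _, _, _; exact R2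
                  | exists q2, (W ++ [(n, u)]), []].
    + destruct p2 as [M U]; exists (Exec n u); repeat split; auto; [discriminate|].
      intros [q'|m v|m|m v]; simpl in *; try lia; unfold ind;
        (destruct (excluded_middle_informative _) as [E|]; [inversion E; subst|]); lia.
    + exact (related_exec _ _ _ _ _ n u _ Mr' R2 Hn Hfree (fun s => eq_refl) Hu Heq).
  - destruct p as [M U], r' as [Mr' Ur'], r as [Mr Ur].
    destruct Hr as (u & Hn & Hnth & Hl & Heq & ->).
    pose proof (rel_run _ _ _ _ _ R) as HU; pose proof (rel_run' _ _ _ _ _ R) as HUr.
    simpl in HU, HUr; subst U Ur.
    rewrite nth_error_map in Hnth; destruct (nth_error W (n - 1)) as [[m u']|] eqn:EW;
      [|discriminate].
    injection Hnth as ->.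
    destruct (nth_error_remove_nth _ _ _ _ Hn EW) as (W1 & W2 & -> & ER).
    set (exec := fun x : nat * T => Exec (fst x) (snd x)) in *.
    exists (M, map exec (W1 ++ (m, u) :: W2)),
      ((fun s => M s + impl_out (Exec m u) s), map exec (W1 ++ W2)).
    repeat split; [constructor | left | eexists _, _, _; exact R
                  | exists q, (W1 ++ W2), ((m, u) :: P)].
    + exists (Exec m u); repeat split; auto.
      * now rewrite nth_error_map, EW.
      * now rewrite remove_nth_map, ER.
    + rewrite remove_nth_map, ER.
      exact (related_end _ _ _ _ _ _ _ _ _ Mr' R (fun s => eq_refl) Heq).
  - destruct r as [Mr Ur], r' as [Mr' Ur'].
    destruct Hr as (t & Hl & _); now apply N_plain in Hl.
Qed.

Lemma impl_equiv : bSTb_div_equiv impl N.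
Proof.
  exists st_bisim; split; [eexists _, _, _; apply related_init|].
  repeat split.
  - exact bisim_impl_spec.
  - exact bisim_spec_impl.
  (* Both divergence conditions are vacuous: [impl] has no infinite invisible run from a related
     state, and [N] has no invisible step. *)
  - intros p r (q & W & P & R) f H0 Hf _; exfalso.
    exact (related_tau_terminates _ _ _ _ _ f R H0 Hf).
  - intros p r _ f _ Hf _; exfalso; specialize (Hf 0).
    destruct (f 0), (f 1), Hf as (t & Hl & _); now apply N_plain in Hl.
Qed.

End Implementation.

Theorem theorem7p12 (Act S T : Type) (N : net Act S T) :
  finitary N -> plain N -> structural_conflict N -> ~ fully_reachable_pure_M N ->
  exists (S' T' : Type) (D : net Act S' T'),
    distributed D /\ bSTb_div_equiv D N.
Proof.
  intros Hf Hp Hc HM; exists (@place S T), (trans N), (impl N).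
  split; [apply impl_distributed | now apply impl_equiv].
Qed.
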